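(* For each integer $l \ge 0$ there exist polynomials $\alpha_l(x)$ and $\beta_l(x)$ with integer coefficients such that for every positive integer $m \ge l$, $$d_l(m) = \frac{1}{l!\, m!\, 2^{m+l}} \left( \alpha_l(m) \prod_{k=1}^m (4k-1) - \beta_l(m) \prod_{k=1}^m (4k+1) \right).$$
   Context: For a positive integer $m$ and real $a > -1$, let $N_{0,4}(a;m) = \int_0^\infty \frac{dx}{(x^4+2ax^2+1)^{m+1}}$. The function $P_m(a) = \frac{2^{m+3/2}}{\pi}(a+1)^{m+1/2} N_{0,4}(a;m)$ is a polynomial of degree $m$ in $a$ with rational coefficients; write $P_m(a) = \sum_{l=0}^m d_l(m) a^l$. *)

(* Defs.v *)
From HB Require Import structures.
From mathcomp Require Import all_boot all_order all_algebra.
From mathcomp Require Import all_classical all_reals all_analysis.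

Set Implicit Arguments.
Unset Strict Implicit.
Unset Printing Implicit Defensive.

Import Order.TTheory GRing.Theory Num.Theory.

Local Open Scope classical_set_scope.
Local Open Scope ring_scope.

(* For -1 < a the integrand is positive and integrable, so that the Lebesgue
   integral agrees with the improper Riemann integral. *)
Definition N04 (R : realType) (a : R) (m : nat) : R :=
  \int[lebesgue_measure]_(x in `[0%R, +oo[)
    ((x ^+ 4 + 2 * a * x ^+ 2 + 1) ^+ m.+1)^-1.

Definition quarticP (R : realType) (m : nat) (a : R) : R :=
  2 `^ (m%:R + 3 / 2) / pi * (a + 1) `^ (m%:R + 1 / 2) * N04 a m.

Definition represents_quarticP (R : realType) (m : nat) (p : {poly rat}) : Prop :=
  size p = m.+1 /\
  forall a : R, -1 < a -> quarticP m a = (map_poly ratr p).[a].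

(* Two polynomials over rat that agree on ]-1, +oo[ are equal, so at most one
   p satisfies the predicate; the default value 0 does not satisfy it. *)
Definition quarticP_poly (R : realType) (m : nat) : {poly rat} :=
  xget 0 [set p | represents_quarticP R m p].

Definition dcoef (R : realType) (l m : nat) : rat := (quarticP_poly R m)`_l.

(* Main.v *)
(* The substitution y = x - 1/x (Cauchy-Schlomilch), applied to the average of
   the integrand and of its image under x -> 1/x, turns N_{0,4}(a;m) into a
   combination of Wallis integrals and gives P_m(a) = q_m(a+1) with
   q_m(t) = sum_j C(m+j,2j) (2j-1)!!(2m-2j-1)!!/(2m)!! (2t)^j.
   These coefficients are hypergeometric, so that P_m satisfies
     2(m+1) P_{m+1} = (2(m+1)a + 4m+3) P_m + 2a(a+1) P_m',
     (1-a^2) P_m'' - (2m+1+2a) P_m' + m(m+1) P_m = 0.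
   The first relation gives d_0(m) and d_1(m) by induction on m. The second is a
   three-term recurrence in l with coefficients polynomial in m: for
   e_l = l! m! 2^(m+l) d_l(m) it reads
     e_{l+2} = 2(2m+1) e_{l+1} - 4(m-l)(m+l+1) e_l,
   which defines alpha_l and beta_l. *)

Require Import Defs.
From HB Require Import structures.
From mathcomp Require Import all_boot all_order all_algebra.
From mathcomp Require Import all_classical all_reals all_analysis.
From mathcomp Require Import ring lra zify.
Set Implicit Arguments.
Unset Strict Implicit.
Unset Printing Implicit Defensive.
Import Order.TTheory GRing.Theory Num.Theory numFieldNormedType.Exports.
Local Open Scope ring_scope.
Local Open Scope classical_set_scope.

(** * Wallis ratios *)

(* (2j-1)!! (2(m-j)-1)!! / (2m)!! for j <= m, so that the integral of
   y^(2j) / (y^2+1)^(m+1) over the positive half-line is pi/2 times it. *)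
Definition wallis (F : fieldType) (j m : nat) : F :=
  \prod_(i < j) (2 * i%:R + 1) * \prod_(i < m - j) (2 * i%:R + 1)
  / \prod_(i < m) (2 * i%:R + 2).

Lemma wallisSS (F : numFieldType) (j m : nat) :
  wallis F j.+1 m.+1 = (2 * j%:R + 1) / (2 * m%:R + 2) * wallis F j m.
Proof.
rewrite /wallis subSS (big_ord_recr j) (big_ord_recr m)/= invfM.
by rewrite -!mulrA; ring.
Qed.

Lemma wallis0S (F : numFieldType) (m : nat) :
  wallis F 0 m.+1 = (2 * m%:R + 1) / (2 * m%:R + 2) * wallis F 0 m.
Proof.
rewrite /wallis !subn0 !big_ord0 !mul1r !(big_ord_recr m)/= invfM.
by rewrite -!mulrA; ring.
Qed.

(** * The Cauchy-Schlomilch substitution on the half-line *)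

Lemma cvgr_invy (R : realType) : (x^-1 : R) @[x --> +oo] --> (0 : R).
Proof.
apply/gtr0_cvgV0 => //.
by near=> x; near: x; apply: nbhs_pinfty_gt; rewrite num_real.
Unshelve. all: by end_near. Qed.

Lemma cvgr_subVy (R : realType) : (x - x^-1 : R) @[x --> +oo] --> +oo.
Proof.
apply/cvgryPge => A; near=> x.
have x1 : 1 <= x by near: x; apply: nbhs_pinfty_ge; rewrite num_real.
have Ax : A + 1 <= x by near: x; apply: nbhs_pinfty_ge; rewrite num_real.
have : x^-1 <= 1 by rewrite invf_le1// (lt_le_trans _ x1).
lra.
Unshelve. all: by end_near. Qed.

(** The base point is arbitrary so that the primitive based at -1 is differentiable, hence
    continuous, at the endpoint 0 of the half-line. *)
Lemma antiderivative_gt (R : realType) (f : R -> R) (c : R) : continuous f ->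
  exists F : R -> R, forall x : R, c < x -> is_derive x 1 F (f x).
Proof.
move=> cf; exists (fun x => \int[lebesgue_measure]_(t in `[c, x]) f t) => x cx.
have xu : x < x + 1 by rewrite ltrDl.
have intf : lebesgue_measure.-integrable `[c, x + 1] (EFin \o f).
  apply: continuous_compact_integrable; first exact: segment_compact.
  exact: continuous_subspaceT.
have [dF F'] := continuous_FTC1_closed xu intf cx (cf x).
by apply: (DeriveDef dF); rewrite -derive1E.
Qed.

(* With x = e^s, the difference F(x) - F(1/x) - G(x - 1/x) is constant. *)
Lemma Rintegral_symmetrized (R : realType) (f g G : R -> R) (L : R) :
  continuous f -> (forall x : R, 0 <= f x) ->
  (forall y : R, is_derive y 1 G (g y)) -> G 0 = 0 -> G y @[y --> +oo] --> L ->
  (forall x : R, 0 < x -> f x + f x^-1 * x^-1 ^+ 2 = g (x - x^-1) * (1 + x^-1 ^+ 2)) ->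
  \int[lebesgue_measure]_(x in `[0, +oo[) f x = L.
Proof.
move=> cf f_ge0 dG G0 GL fg.
have [F dF] := antiderivative_gt (-1) cf.
have dF1 (x : R) : -1 < x -> derivable F x 1 by move=> /dF [].
have FVG (x : R) : 0 < x -> F x = F x^-1 + G (x - x^-1).
  pose K (s : R) := F (expR s) - F (expR (- s)) - G (expR s - expR (- s)).
  have K0 (s : R) : is_derive s 1 K 0.
    have e0 (t : R) : -1 < expR t :> R by rewrite (lt_trans _ (expR_gt0 t)).
    have dN : is_derive s 1 (fun t : R => expR (- t)) (- expR (- s)).
      have := is_derive1_comp (is_derive_expR (- s)) (is_deriveNid s 1).
      by rewrite mulrN1.
    have dK1 := is_derive1_comp (dF _ (e0 s)) (is_derive_expR s).
    have dK2 := is_derive1_comp (g := fun t => expR (- t)) (dF _ (e0 (- s))) dN.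
    have dK3 := is_derive1_comp (g := expR - (fun t => expR (- t))) (dG (expR s - expR (- s)))
      (is_deriveB (is_derive_expR s) dN).
    apply: is_derive_eq (is_deriveB (is_deriveB dK1 dK2) dK3) _.
    have := fg _ (expR_gt0 s); rewrite -expRN => e.
    have ee : expR s * expR (- s) = 1 by rewrite -expRD subrr expR0.
    (* The derivative of [K] is e^s times the difference of the two sides of [fg] at x = e^s. *)
    transitivity (expR s * (f (expR s) + f (expR (- s)) * expR (- s) ^+ 2 -
      g (expR s - expR (- s)) * (1 + expR (- s) ^+ 2))); last by rewrite e subrr mulr0.
    transitivity (expR s * f (expR s) + f (expR (- s)) * (expR s * expR (- s)) * expR (- s) -
      g (expR s - expR (- s)) * (expR s + expR s * expR (- s) * expR (- s))); last by ring.
    by rewrite ee; ring.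
  move=> x0; have := is_derive_0_is_cst (ln x) 0 K0.
  rewrite /K expRN lnK ?posrE// oppr0 !subrr G0 subr0 => /eqP.
  by rewrite subr_eq0 subr_eq addrC => /eqP.
have F0 : {for 0, continuous F}.
  by apply/differentiable_continuous/derivable1_diffP/dF1; rewrite ltrN10.
(* In [FVG], x^-1 tends to 0 and x - x^-1 to infinity, which gives the limit of [F]. *)
have Fl : F x @[x --> +oo] --> F 0 + L.
  have : F x^-1 + G (x - x^-1) @[x --> +oo] --> F 0 + L.
    apply: cvgD; first exact: (cvg_comp _ _ (@cvgr_invy R) F0).
    exact: (cvg_comp _ _ (@cvgr_subVy R) GL).
  apply: cvg_trans; apply: near_eq_cvg; near=> x.
  by rewrite -FVG//; near: x; apply: nbhs_pinfty_gt; rewrite num_real.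
rewrite (Rintegral_ge0_continuous_FTC2y (F := F) (l := F 0 + L))//.
- by rewrite addrC addKr.
- exact: continuous_subspaceT.
- by move=> x x0; apply: dF1; rewrite (lt_trans _ x0).
- exact: cvg_at_right_filter.
- move=> x; rewrite in_itv/= andbT => x0.
  by rewrite derive1E; apply: derive_val; apply: dF; rewrite (lt_trans _ x0).
Unshelve. all: by end_near. Qed.

(** * Wallis integrals by antiderivatives and their limits *)

Lemma cvg_pow_ratio (R : realType) (r : R) (j m : nat) : (j <= m)%N ->
  y ^+ (2 * j).+1 / (y ^+ 2 + r ^+ 2) ^+ m.+1 @[y --> +oo] --> (0 : R).
Proof.
move=> jm; apply: (squeeze_cvgr _ (cvg_cst 0) (@cvgr_invy R)).
near=> y.
have y1 : 1 <= y by near: y; apply: nbhs_pinfty_ge; rewrite num_real.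
have y0 : 0 < y by rewrite (lt_le_trans _ y1).
have r2 : 0 <= r ^+ 2 by rewrite sqr_ge0.
have q0 : 0 < y ^+ 2 + r ^+ 2 by rewrite ltr_pwDl// exprn_gt0.
apply/andP; split; first by rewrite divr_ge0// exprn_ge0// ltW.
rewrite ler_pdivrMr ?exprn_gt0// mulrC ler_pdivlMr// -exprSr.
apply: (@le_trans _ _ ((y ^+ 2) ^+ m.+1)).
  by rewrite -exprM ler_weXn2l//; lia.
by rewrite lerXn2r ?nnegrE ?sqr_ge0 ?(ltW q0)// lerDl.
Unshelve. all: by end_near. Qed.

Lemma is_derive_exprn (R : realType) (n : nat) (x : R) :
  is_derive x 1 (fun z : R => z ^+ n) (n%:R * x ^+ n.-1).
Proof.
have := is_deriveX n (is_derive_id x 1); rewrite exprfctE.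
by move=> dX; apply: is_derive_eq dX _; rewrite /GRing.scale/= mulr1.
Qed.

(* The antiderivatives are built by integration by parts,
   d(y^(2j+1) / (y^2+r^2)^(m+1)), and by y^2 = (y^2 + r^2) - r^2. *)
Lemma wallis_antiderivative (R : realType) (r : R) (m j : nat) : 0 < r -> (j <= m)%N ->
  exists A : R -> R,
    [/\ forall y : R, is_derive y 1 A (y ^+ (2 * j) / (y ^+ 2 + r ^+ 2) ^+ m.+1),
        A 0 = 0 &
        A y @[y --> +oo] --> pi / 2 * wallis R j m * r ^+ (2 * j) / r ^+ (2 * m).+1].
Proof.
move=> r0.
have rn0 : r != 0 by rewrite gt_eqF.
have q0 (y : R) : y ^+ 2 + r ^+ 2 != 0.
  by rewrite gt_eqF// ltr_wpDl ?sqr_ge0// exprn_gt0.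
elim: m j => [|m IHm].
  case=> // _; exists (fun y => r^-1 * atan (r^-1 * y)); split.
  - move=> y.
    have d1 := is_derive1_comp (is_derive1_atan (r^-1 * y)) (is_deriveZ r^-1 (is_derive_id y 1)).
    apply: is_derive_eq (is_deriveZ r^-1 d1) _.
    rewrite /GRing.scale/= muln0 expr0 expr1 mulr1 div1r.
    have q1 : 1 + (r^-1 * y) ^+ 2 != 0.
      by rewrite gt_eqF// ltr_pwDl ?sqr_ge0.
    have := q0 y; move: q1; rewrite exprMn exprVn => q1 qy.
    by field; rewrite qy rn0.
  - by rewrite mulr0 atan0 mulr0.
  - have -> : pi / 2 * wallis R 0 0 * r ^+ (2 * 0) / r ^+ (2 * 0).+1 = r^-1 * (pi / 2).
      by rewrite /wallis !big_ord0 muln0 expr0 expr1; field.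
    apply: cvgMr.
    have ry : r^-1 * y @[y --> +oo] --> +oo by apply: gt0_cvgMry; rewrite ?invr_gt0.
    exact: (cvg_comp _ _ ry (@cvgy_atan R)).
have m20 : 2 * m%:R + 2 != 0 :> R by rewrite gt_eqF// ltr_wpDl// mulr_ge0.
have stepSS j : (j <= m)%N -> exists A : R -> R,
    [/\ forall y : R, is_derive y 1 A (y ^+ (2 * j.+1) / (y ^+ 2 + r ^+ 2) ^+ m.+2),
        A 0 = 0 &
        A y @[y --> +oo] -->
          pi / 2 * wallis R j.+1 m.+1 * r ^+ (2 * j.+1) / r ^+ (2 * m.+1).+1].
  move=> jm; have [A [dA A0 Al]] := IHm _ jm.
  (* The boundary term of the integration by parts vanishes at 0 and, by [cvg_pow_ratio], at
     infinity, so it contributes nothing to the limit. *)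
  pose B (y : R) := y ^+ (2 * j).+1 / (y ^+ 2 + r ^+ 2) ^+ m.+1.
  have dB (y : R) : is_derive y 1 B ((2 * j%:R + 1) * (y ^+ (2 * j) / (y ^+ 2 + r ^+ 2) ^+ m.+1)
      - (2 * m%:R + 2) * (y ^+ (2 * j.+1) / (y ^+ 2 + r ^+ 2) ^+ m.+2)).
    have dq := is_deriveD (is_derive_exprn 2 y) (is_derive_cst (r ^+ 2) y 1).
    have dqm := is_derive1_comp (g := fun z => z ^+ 2 + r ^+ 2)
      (is_derive_exprn m.+1 (y ^+ 2 + r ^+ 2)) dq.
    have qm0 : (y ^+ 2 + r ^+ 2) ^+ m.+1 != 0 by rewrite expf_neq0.
    have dqV := is_deriveV (f := fun z => (z ^+ 2 + r ^+ 2) ^+ m.+1) qm0 dqm.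
    apply: is_derive_eq (is_deriveM (is_derive_exprn (2 * j).+1 y) dqV) _.
    rewrite /GRing.scale/= (_ : 2 * j.+1 = (2 * j).+2)%N; last by lia.
    move: (q0 y); set Q := y ^+ 2 + r ^+ 2 => Q0; rewrite !exprS expr0.
    by field; rewrite Q0 expf_neq0.
  exists (fun y => (2 * m%:R + 2)^-1 * ((2 * j%:R + 1) * A y - B y)); split.
  - move=> y.
    apply: is_derive_eq (is_deriveZ _ (is_deriveB (is_deriveZ (2 * j%:R + 1) (dA y)) (dB y))) _.
    by rewrite /GRing.scale/=; field; rewrite ?expf_neq0 ?q0 ?rn0 ?m20.
  - by rewrite /B A0 mulr0 expr0n/= mul0r subrr mulr0.
  - have -> : pi / 2 * wallis R j.+1 m.+1 * r ^+ (2 * j.+1) / r ^+ (2 * m.+1).+1 =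
        (2 * m%:R + 2)^-1 * ((2 * j%:R + 1) *
          (pi / 2 * wallis R j m * r ^+ (2 * j) / r ^+ (2 * m).+1) - 0).
      rewrite wallisSS !mulnS !add2n.
      by rewrite !exprS; field; rewrite ?expf_neq0 ?q0 ?rn0 ?m20.
    by apply: cvgMr; apply: cvgB; [apply: cvgMr|apply: cvg_pow_ratio].
case=> [_|j]; last by rewrite ltnS; exact: stepSS.
have [A [dA A0 Al]] := IHm _ (leq0n m).
have [B [dB B0 Bl]] := stepSS _ (leq0n m).
(* With Q = y^2 + r^2, this primitive comes from r^2 / Q^(m+2) = 1 / Q^(m+1) - y^2 / Q^(m+2). *)
exists (fun y => r ^- 2 * (A y - B y)); split.
- move=> y.
  apply: is_derive_eq (is_deriveZ _ (is_deriveB (dA y) (dB y))) _.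
  rewrite /GRing.scale/= !muln1 !muln0 expr0 !(exprS _ m.+1).
  by field; rewrite ?expf_neq0 ?q0 ?rn0 ?m20.
- by rewrite A0 B0 subrr mulr0.
- have -> : pi / 2 * wallis R 0 m.+1 * r ^+ (2 * 0) / r ^+ (2 * m.+1).+1 =
      r ^- 2 * (pi / 2 * wallis R 0 m * r ^+ (2 * 0) / r ^+ (2 * m).+1 -
        pi / 2 * wallis R 1 m.+1 * r ^+ (2 * 1) / r ^+ (2 * m.+1).+1).
    rewrite wallisSS wallis0S muln0 muln1 mulnS add2n.
    by rewrite !exprS !expr0; field; rewrite ?expf_neq0 ?q0 ?rn0 ?m20.
  by apply: cvgMr; apply: cvgB.
Qed.

(** * The binomial expansion in powers of x - 1/x *)

Lemma bin_diff2 (n p : nat) :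
  ('C(n.+2, p.+2) + 'C(n, p.+2) = 2 * 'C(n.+1, p.+2) + 'C(n, p))%N.
Proof. by rewrite (binS n.+1) (binS n p.+1) (binS n p); lia. Qed.

(* With x = e^t this is the expansion of cosh ((2m+1) t) / cosh t in powers of
   2 sinh t; the terms with j > m vanish. *)
Lemma sum_bin_symmetric (F : fieldType) (x : F) (m n : nat) : x != 0 -> (m < n)%N ->
  (x + x^-1) * \sum_(j < n) 'C(m + j, 2 * j)%:R * (x - x^-1) ^+ (2 * j) =
  x ^+ (2 * m).+1 + x^-1 ^+ (2 * m).+1.
Proof.
move=> x0; have xV : x * x^-1 = 1 by rewrite divff.
set y := x - x^-1.
(* The range n stays fixed while m varies, so that sums for different m can be compared term by
   term. *)
pose S m := \sum_(j < n) 'C(m + j, 2 * j)%:R * y ^+ (2 * j).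
have S0 : (0 < n)%N -> S 0%N = 1.
  rewrite /S; case: n {S} => // n _; rewrite big_ord_recl big1 ?addr0 ?mulr1// => i _.
  by rewrite bin_small ?mul0r//= /bump; lia.
have S1 : (1 < n)%N -> S 1%N = 1 + y ^+ 2.
  rewrite /S; case: n {S S0} => [|[|n]]// _; rewrite 2!big_ord_recl big1 ?addr0 => [|i _].
    by rewrite /= /bump/= !mul1r.
  by rewrite bin_small ?mul0r//= /bump; lia.
(* The second difference in m of the binomials lowers j by one ([bin_diff2]), which is
   multiplication by y^2. Since x^2 + x^-2 = 2 + y^2, the right-hand side of the lemma, divided by x
   + x^-1, obeys the same recurrence. *)
have SS k : (k.+2 < n)%N -> S k.+2 = (2 + y ^+ 2) * S k.+1 - S k.
  rewrite /S mulrDl; case: n {S S0 S1} => // n kn.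
  have -> : y ^+ 2 * (\sum_(j < n.+1) 'C(k.+1 + j, 2 * j)%:R * y ^+ (2 * j)) =
      \sum_(j < n) 'C(k.+1 + j, 2 * j)%:R * y ^+ (2 * j.+1).
    rewrite big_ord_recr/= [X in _ + X](_ : _ = 0) ?addr0; last first.
      by rewrite bin_small ?mul0r//; lia.
    rewrite mulr_sumr; apply: eq_bigr => j _.
    by rewrite mulrCA -exprD; congr (_ * _ ^+ _); lia.
  rewrite !big_ord_recl/= !muln0 !bin0 !expr0.
  rewrite mulrDr mulr_sumr.
  rewrite [X in 1%:R * 1 + X = _](_ : _ = \sum_(j < n) (2 * ('C(k.+1 + bump 0 j, 2 * bump 0 j)%:R *
      y ^+ (2 * bump 0 j)) + 'C(k.+1 + j, 2 * j)%:R * y ^+ (2 * j.+1) -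
      'C(k + bump 0 j, 2 * bump 0 j)%:R * y ^+ (2 * bump 0 j))).
    by rewrite sumrB big_split/=; ring.
  apply: eq_bigr => j _; rewrite /bump/= !add1n.
  have -> : (2 * j.+1 = (2 * j).+2)%N by lia.
  have -> : (k.+2 + j.+1 = (k + j).+1.+2)%N by lia.
  have -> : (k.+1 + j.+1 = (k + j).+2)%N by lia.
  have -> : (k + j.+1 = (k + j).+1)%N by lia.
  rewrite addSn; move: (k + j)%N (2 * j)%N => p q.
  rewrite [X in X * _ = _](_ : _ = 2 * 'C(p.+2, q.+2)%:R + 'C(p.+1, q)%:R - 'C(p.+1, q.+2)%:R).
    by ring.
  by apply/eqP; rewrite eq_sym subr_eq -natrM -!natrD -bin_diff2.
rewrite -/(S m).
(* The recurrence has order two, so the induction carries two consecutive values of m. *)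
have [] : ((m < n)%N -> (x + x^-1) * S m = x ^+ (2 * m).+1 + x^-1 ^+ (2 * m).+1) /\
  ((m.+1 < n)%N -> (x + x^-1) * S m.+1 = x ^+ (2 * m.+1).+1 + x^-1 ^+ (2 * m.+1).+1).
  elim: m => [|m [IH IH1]].
    split=> [/S0 ->|/S1 ->]; first by rewrite mulr1.
    rewrite muln1 /y !exprS !expr0.
    transitivity (x * x * x + x^-1 * x^-1 * x^-1 + (x + x^-1) * (1 - x * x^-1)); first by ring.
    by rewrite xV; ring.
  split=> // mn; rewrite SS// mulrBr mulrCA IH1 1?ltnW// IH; last by lia.
  have -> : (2 * m.+2 = (2 * m).+4)%N by lia.
  have -> : (2 * m.+1 = (2 * m).+2)%N by lia.
  by rewrite !exprS /y; field.
by [].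
Qed.

(** * Coefficients at a = -1 and their hypergeometric relations *)

Lemma factr_neq0 (n : nat) : n`!%:R != 0 :> rat.
Proof. by rewrite pnatr_eq0 -lt0n fact_gt0. Qed.

Lemma exp2_neq0 (n : nat) : 2 ^+ n != 0 :> rat.
Proof. by rewrite expf_neq0. Qed.

(* The coefficient of (a+1)^j in P_m(a). *)
Definition taylor_coef (m j : nat) : rat :=
  'C(m + j, 2 * j)%:R * wallis rat j m * 2 ^+ j.

Lemma taylor_coef_small (m j : nat) : (m < j)%N -> taylor_coef m j = 0.
Proof. by move=> mj; rewrite /taylor_coef bin_small ?mul0r//; lia. Qed.

Lemma prod_even (n : nat) : \prod_(i < n) (2 * i%:R + 2) = 2 ^+ n * n`!%:R :> rat.
Proof.
elim: n => [|n IHn]; first by rewrite big_ord0 mulr1.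
by rewrite big_ord_recr/= IHn factS natrM exprS -natr1; ring.
Qed.

Lemma prod_odd (n : nat) :
  \prod_(i < n) (2 * i%:R + 1) = (2 * n)`!%:R / (2 ^+ n * n`!%:R) :> rat.
Proof.
elim: n => [|n IHn]; first by rewrite big_ord0 muln0 fact0; field.
rewrite big_ord_recr/= IHn.
have -> : (2 * n.+1 = (2 * n).+2)%N by lia.
rewrite !factS !natrM exprS.
by field; rewrite factr_neq0 expf_neq0//= nat1r pnatr_eq0.
Qed.

(** Setting m = j + k removes the truncated subtraction. One odd product is left unevaluated, since
    neighbouring coefficients differ there by at most one last factor. *)
Lemma taylor_coefE (j k : nat) :
  taylor_coef (j + k) j =
  (2 * j + k)`!%:R / (k`!%:R * j`!%:R * (j + k)`!%:R * 2 ^+ (j + k))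
  * \prod_(i < k) (2 * i%:R + 1).
Proof.
rewrite /taylor_coef /wallis addKn prod_even (prod_odd j).
have -> : 'C(j + k + j, 2 * j)%:R = (2 * j + k)`!%:R / ((2 * j)`!%:R * k`!%:R) :> rat.
  have le2 : (2 * j <= j + k + j)%N by lia.
  have := bin_fact le2.
  have -> : (j + k + j - 2 * j = k)%N by lia.
  have -> : (j + k + j = 2 * j + k)%N by lia.
  by move=> <-; rewrite !natrM; field; rewrite !factr_neq0.
by field; rewrite !factr_neq0 !exp2_neq0.
Qed.

Lemma taylor_coef_rec0 (m : nat) :
  (2 * m%:R + 2) * taylor_coef m.+1 0 = (2 * m%:R + 1) * taylor_coef m 0.
Proof.
have := taylor_coefE 0 m; have := taylor_coefE 0 m.+1.
rewrite !muln0 !add0n => -> ->.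
rewrite big_ord_recr/= !factS !natrM exprS.
by field; rewrite !factr_neq0 !exp2_neq0//= !(nat1r, natr1, =^~ natrD, pnatr_eq0).
Qed.

(** For j < m the three coefficients are rational multiples of one hypergeometric term, and
    cancelling it leaves an identity of rational functions. At j = m one of them vanishes, and
    beyond that all do. *)
Lemma taylor_coef_rec (m j : nat) :
  (2 * m%:R + 2) * taylor_coef m.+1 j.+1 =
  2 * (m%:R + j%:R + 1) * taylor_coef m j
  + (2 * m%:R - 2 * j%:R - 1) * taylor_coef m j.+1.
Proof.
have [mj|jm|<-] := ltngtP m j.
- by rewrite !taylor_coef_small ?mulr0 ?addr0// ltnS ltnW.
- have [k ->] : exists k, m = (j + k.+1)%N by exists (m - j.+1)%N; lia.
  rewrite taylor_coefE -addSn taylor_coefE.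
  have := taylor_coefE j.+1 k.
  rewrite addSnnS => ->.
  have -> : (2 * j.+1 + k.+1 = (2 * j + k.+1).+2)%N by lia.
  have -> : (2 * j.+1 + k = (2 * j + k.+1).+1)%N by lia.
  rewrite addSn big_ord_recr/= !factS !natrM !exprS.
  by field; rewrite !factr_neq0 !exp2_neq0//= !(nat1r, natr1, =^~ natrD, pnatr_eq0).
- rewrite (@taylor_coef_small m m.+1)// mulr0 addr0.
  have := taylor_coefE m 0; have := taylor_coefE m.+1 0.
  rewrite !addn0 => -> ->.
  have -> : (2 * m.+1 = (2 * m).+2)%N by lia.
  rewrite !factS !natrM exprS.
  by field; rewrite !factr_neq0 !exp2_neq0//= !(nat1r, natr1, =^~ natrD, pnatr_eq0).
Qed.

Lemma taylor_coef_ratio (m j : nat) :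
  j.+1%:R * (2 * m%:R - 2 * j%:R - 1) * taylor_coef m j.+1 =
  (m%:R - j%:R) * (m%:R + j%:R + 1) * taylor_coef m j.
Proof.
have [mj|jm|<-] := ltngtP m j.
- by rewrite !taylor_coef_small ?mulr0 ?addr0// ltnS ltnW.
- have [k ->] : exists k, m = (j + k.+1)%N by exists (m - j.+1)%N; lia.
  rewrite taylor_coefE.
  have := taylor_coefE j.+1 k.
  rewrite addSnnS => ->.
  have -> : (2 * j.+1 + k = (2 * j + k.+1).+1)%N by lia.
  rewrite big_ord_recr/= !factS !natrM.
  by field; rewrite !factr_neq0 !exp2_neq0//= !(nat1r, natr1, =^~ natrD, pnatr_eq0).
- by rewrite taylor_coef_small// (subrr m%:R) !(mulr0, mul0r).
Qed.

(** * The polynomials, their recurrence in m and their differential equation *)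

Definition taylor_poly (m : nat) : {poly rat} := \poly_(j < m.+1) taylor_coef m j.

Definition quartic_poly (m : nat) : {poly rat} := taylor_poly m \Po ('X + 1).

Lemma coef_taylor_poly (m j : nat) : (taylor_poly m)`_j = taylor_coef m j.
Proof. by rewrite coef_poly; case: ltnP => // /taylor_coef_small. Qed.

Lemma deriv_Xadd1 : deriv ('X + 1) = 1 :> {poly rat}.
Proof. by rewrite poly.derivD poly.derivX -[1]/1%:P derivC addr0. Qed.

(* The derivative is written [deriv] because the postfix notation denotes
   [derive1] once analysis is imported. *)
Lemma taylor_poly_rec (m : nat) :
  (2 * m%:R + 2) *: taylor_poly m.+1 =
  (2 * m%:R + 2) *: (taylor_poly m * 'X) + (2 * m%:R + 1) *: taylor_poly m
  + 2 *: (deriv (taylor_poly m) * 'X * ('X - 1)).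
Proof.
rewrite mulrBr mulr1.
apply/polyP => -[|[|j]]; rewrite !(coefD, coefN, coefZ, coefMX, coef_deriv, coef_taylor_poly)/=.
- by rewrite taylor_coef_rec0; ring.
- by rewrite taylor_coef_rec; ring.
- by rewrite taylor_coef_rec; ring.
Qed.

(** Comparing coefficients of t^j turns the equation into [taylor_coef_ratio]. The singular points t
    = 0 and t = 2 correspond to a = -1 and a = 1. *)
Lemma taylor_poly_ode (m : nat) :
  (m%:R * m.+1%:R) *: taylor_poly m =
  deriv (deriv (taylor_poly m)) * 'X * ('X - 2) + (2 * m%:R - 1) *: deriv (taylor_poly m)
  + 2 *: (deriv (taylor_poly m) * 'X).
Proof.
have -> : ('X - 2 : {poly rat}) = 'X - 2%:P by rewrite rmorph_nat.
rewrite mulrBr.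
apply/polyP => j.
have := taylor_coef_ratio m j.
by case: j => [|[|j]] ratio;
  rewrite !(coefD, coefN, coefZ, coefMC, coefMX, coef_deriv, coef_taylor_poly)/=;
  move: ratio; lra.
Qed.

(** The substitution t = a + 1 has derivative 1, so it carries [taylor_poly_rec] over with
    derivatives unchanged. *)
Lemma quartic_poly_rec (m : nat) :
  (2 * m%:R + 2) *: quartic_poly m.+1 =
  (2 * m%:R + 2) *: (quartic_poly m * 'X) + (4 * m%:R + 3) *: quartic_poly m
  + 2 *: (deriv (quartic_poly m) * 'X * 'X + deriv (quartic_poly m) * 'X).
Proof.
have comp1 : 1 \Po ('X + 1) = 1 :> {poly rat} by rewrite -[1]/1%:P comp_polyC.
have compX : 'X \Po ('X + 1) = 'X + 1 :> {poly rat} by rewrite comp_polyX.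
have := congr1 (fun p => p \Po ('X + 1)) (taylor_poly_rec m).
rewrite !(comp_polyD, comp_polyB, comp_polyZ, comp_polyM, compX, comp1).
rewrite /quartic_poly deriv_comp deriv_Xadd1 mulr1 => ->.
by rewrite -!mul_polyC; ring.
Qed.

Lemma quartic_poly_ode (m : nat) :
  (m%:R * m.+1%:R) *: quartic_poly m =
  deriv (deriv (quartic_poly m)) * 'X * 'X - deriv (deriv (quartic_poly m))
  + (2 * m%:R + 1) *: deriv (quartic_poly m) + 2 *: (deriv (quartic_poly m) * 'X).
Proof.
have comp2 : 2 \Po ('X + 1) = 2 :> {poly rat} by rewrite -polyC_natr comp_polyC.
have compX : 'X \Po ('X + 1) = 'X + 1 :> {poly rat} by rewrite comp_polyX.
have := congr1 (fun p => p \Po ('X + 1)) (taylor_poly_ode m).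
rewrite !(comp_polyD, comp_polyB, comp_polyZ, comp_polyM, compX, comp2).
rewrite /quartic_poly !deriv_comp deriv_Xadd1 !mulr1 deriv_comp deriv_Xadd1 mulr1 => ->.
by rewrite -!mul_polyC; ring.
Qed.

Lemma coef_quartic_poly_recS (m l : nat) :
  (2 * m%:R + 2) * (quartic_poly m.+1)`_l.+1 =
  2 * (m%:R + l%:R + 1) * (quartic_poly m)`_l
  + (4 * m%:R + 2 * l%:R + 5) * (quartic_poly m)`_l.+1.
Proof.
have /(congr1 (fun p : {poly rat} => p`_l.+1)) := quartic_poly_rec m.
by case: l => [|l]; rewrite !(coefD, coefZ, coefMX, coef_deriv)/= => ->; ring.
Qed.

Lemma coef_quartic_poly_rec0 (m : nat) :
  (2 * m%:R + 2) * (quartic_poly m.+1)`_0 = (4 * m%:R + 3) * (quartic_poly m)`_0.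
Proof.
have /(congr1 (fun p : {poly rat} => p`_0)) := quartic_poly_rec m.
by rewrite !(coefD, coefZ, coefMX, coef_deriv)/= => ->; ring.
Qed.

Lemma coef_quartic_poly_ode (m l : nat) :
  l.+2%:R * l.+1%:R * (quartic_poly m)`_l.+2 =
  (2 * m%:R + 1) * l.+1%:R * (quartic_poly m)`_l.+1
  - (m%:R - l%:R) * (m%:R + l%:R + 1) * (quartic_poly m)`_l.
Proof.
have /(congr1 (fun p : {poly rat} => p`_l)) := quartic_poly_ode m.
by case: l => [|[|l]]; rewrite !(coefD, coefN, coefZ, coefMX, coef_deriv)/=; lra.
Qed.

(** * The normalised coefficients e_l and the polynomials alpha and beta *)

Definition quartic_num (m l : nat) : rat :=
  (quartic_poly m)`_l * (l`!%:R * m`!%:R * 2 ^+ (m + l)).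

Definition prod_4km1 (m : nat) : rat := \prod_(1 <= k < m.+1) (4 * k%:R - 1).
Definition prod_4kp1 (m : nat) : rat := \prod_(1 <= k < m.+1) (4 * k%:R + 1).

Lemma quartic_poly0 : quartic_poly 0 = 1.
Proof.
rewrite /quartic_poly (_ : taylor_poly 0 = 1%:P) ?comp_polyC//.
apply/polyP => j; rewrite coef_taylor_poly coefC.
by case: j => [|j]; [rewrite /taylor_coef /wallis !big_ord0 | rewrite taylor_coef_small].
Qed.

(** Each step from m to m+1 multiplies e_0 by 4m+3 = 4(m+1) - 1. *)
Lemma quartic_num0 (m : nat) : quartic_num m 0 = prod_4km1 m.
Proof.
rewrite /quartic_num /prod_4km1.
elim: m => [|m IHm]; first by rewrite big_geq// quartic_poly0 coef1.
rewrite big_nat_recr//= -IHm !addn0 factS natrM exprS.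
rewrite -[m.+1%:R]natr1.
have := coef_quartic_poly_rec0 m; set x := (quartic_poly m.+1)`_0 => Hx.
transitivity ((2 * m%:R + 2) * x * (0`!%:R * m`!%:R * 2 ^+ m)); first by ring.
by rewrite Hx; ring.
Qed.

(** The recurrence e_1(m+1) = (4m+5) e_1(m) + 4(m+1) e_0(m) has [prod_4kp1] as homogeneous solution,
    and (2m+1) times [prod_4km1] as particular solution because 4(m+1) + (4m+5)(2m+1) =
    (2m+3)(4m+3). *)
Lemma quartic_num1 (m : nat) :
  quartic_num m 1 = (2 * m%:R + 1) * prod_4km1 m - prod_4kp1 m.
Proof.
elim: m => [|m IHm].
  rewrite /quartic_num /prod_4km1 /prod_4kp1 !big_geq// quartic_poly0 coef1/=.
  by rewrite mul0r; ring.
transitivity (4 * (m%:R + 1) * quartic_num m 0 + (4 * m%:R + 5) * quartic_num m 1).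
  rewrite /quartic_num !addn0 !addn1 (factS m) natrM !exprS.
  have := coef_quartic_poly_recS m 0; set x := (quartic_poly m.+1)`_1 => Hx.
  transitivity ((2 * m%:R + 2) * x * (1`!%:R * m`!%:R * (2 * 2 ^+ m))); first by ring.
  by rewrite Hx fact0 factS fact0; ring.
rewrite quartic_num0 IHm /prod_4km1 /prod_4kp1.
by rewrite !(big_nat_recr m.+1)//=; ring.
Qed.

Lemma quartic_num_rec (m l : nat) :
  quartic_num m l.+2 =
  2 * (2 * m%:R + 1) * quartic_num m l.+1
  - 4 * (m%:R - l%:R) * (m%:R + l%:R + 1) * quartic_num m l.
Proof.
rewrite /quartic_num !addnS !factS !natrM !exprS.
have := coef_quartic_poly_ode m l; set x := (quartic_poly m)`_l.+2 => Hx.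
transitivity (l.+2%:R * l.+1%:R * x * (l`!%:R * m`!%:R * (4 * 2 ^+ (m + l)))).
  by ring.
by rewrite Hx; ring.
Qed.

(** The recurrence in l has integer polynomials in m as coefficients and acts linearly on the two
    products, so it acts on alpha and beta separately. Having order two, it needs an induction on
    the pairs for l and l+1. *)
Lemma quartic_numE (l : nat) :
  exists alpha beta : {poly int}, forall m : nat,
    quartic_num m l = alpha.[m%:Z]%:~R * prod_4km1 m - beta.[m%:Z]%:~R * prod_4kp1 m.
Proof.
suff [a [b [_ [_ [Hl _]]]]] : exists alpha beta alpha' beta' : {poly int},
    (forall m, quartic_num m l =
       alpha.[m%:Z]%:~R * prod_4km1 m - beta.[m%:Z]%:~R * prod_4kp1 m) /\
    (forall m, quartic_num m l.+1 =
       alpha'.[m%:Z]%:~R * prod_4km1 m - beta'.[m%:Z]%:~R * prod_4kp1 m).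
  by exists a, b.
elim: l => [|l [a [b [a' [b' [IHl IHl']]]]]].
  exists 1, 0, (2%:P * 'X + 1), 1; split=> m.
    by rewrite quartic_num0 !hornerE; ring.
  by rewrite quartic_num1 !hornerE intrD intrM; ring.
pose step (p p' : {poly int}) :=
  2%:P * (2%:P * 'X + 1) * p' - 4%:P * ('X - l%:Z%:P) * ('X + l%:Z%:P + 1) * p.
exists a', b', (step a a'), (step b b'); split=> // m.
rewrite quartic_num_rec (IHl m) (IHl' m) /step.
rewrite !(hornerD, hornerN, hornerM, hornerC, hornerX).
rewrite !(intrD, intrM, rmorphN)/=.
by ring.
Qed.

(** * Evaluation of the quartic integral *)

Lemma quartic_gt0 (R : realFieldType) (a x : R) :
  -1 < a -> 0 < x ^+ 4 + 2 * a * x ^+ 2 + 1.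
Proof.
move=> a1; rewrite (_ : _ + 1 = (x ^+ 2 - 1) ^+ 2 + 2 * (a + 1) * x ^+ 2); last by ring.
have [->|x0] := eqVneq x 0; first by rewrite expr0n/= sub0r sqrrN mulr0 addr0 expr1n.
rewrite ltr_wpDl ?sqr_ge0// mulr_gt0 ?exprn_even_gt0//.
by rewrite mulr_gt0// -ltrBlDr sub0r.
Qed.

(** Divided by x^2 the quartic is (x - 1/x)^2 + r^2 with r^2 = 2(a+1). Hence [Rintegral_symmetrized]
    applies, and [sum_bin_symmetric] splits the symmetrized integrand into Wallis integrands. *)
Lemma N04E (R : realType) (m : nat) (a : R) : -1 < a ->
  N04 a m = \sum_(j < m.+1) 'C(m + j, 2 * j)%:R *
    (pi / 2 * wallis R j m * Num.sqrt (2 * (a + 1)) ^+ (2 * j)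
     / Num.sqrt (2 * (a + 1)) ^+ (2 * m).+1).
Proof.
move=> a1; have b0 : 0 < 2 * (a + 1) by lra.
set r := Num.sqrt _; have r0 : 0 < r by rewrite sqrtr_gt0.
have rE : r ^+ 2 = 2 * (a + 1) by rewrite sqr_sqrtr// ltW.
have /choice[A HA] (j : 'I_m.+1) : exists A : R -> R,
    [/\ forall y : R, is_derive y 1 A (y ^+ (2 * j) / (y ^+ 2 + r ^+ 2) ^+ m.+1),
        A 0 = 0 &
        A y @[y --> +oo] --> pi / 2 * wallis R j m * r ^+ (2 * j) / r ^+ (2 * m).+1].
  by apply: wallis_antiderivative r0 _; rewrite -ltnS.
pose G : R -> R := \sum_(j < m.+1) (fun y => 'C(m + j, 2 * j)%:R * A j y).
apply: (@Rintegral_symmetrized _ _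
  (fun y => \sum_(j < m.+1) 'C(m + j, 2 * j)%:R * (y ^+ (2 * j) / (y ^+ 2 + r ^+ 2) ^+ m.+1)) G).
- move=> x; have q0 := quartic_gt0 x a1.
  apply: cvgV; first by rewrite expf_neq0// gt_eqF.
  apply: (cvg_comp (fun x => x ^+ 4 + 2 * a * x ^+ 2 + 1) (fun z => z ^+ m.+1));
    last exact: exprn_continuous.
  apply: cvgD; last exact: cvg_cst.
  by apply: cvgD; [apply: exprn_continuous|apply: cvgMr; apply: exprn_continuous].
- by move=> x; rewrite invr_ge0 exprn_ge0// ltW// quartic_gt0.
- move=> y; apply: is_derive_sum => j; have [dA _ _] := HA j.
  exact: is_deriveZ.
- rewrite /G fct_sumE big1// => j _.
  by have [_ -> _] := HA j; rewrite mulr0.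
- rewrite /G fct_sumE; apply: cvg_big => [|j _]; first exact: add_continuous.
  have [_ _ Al] := HA j.
  exact: cvgMr.
- move=> x x0; have xn0 : x != 0 by rewrite gt_eqF.
  have q0 : x ^+ 4 + 2 * a * x ^+ 2 + 1 != 0 by rewrite gt_eqF// quartic_gt0.
  have qV : (x^-1) ^+ 4 + 2 * a * (x^-1) ^+ 2 + 1 = (x ^+ 4 + 2 * a * x ^+ 2 + 1) / x ^+ 4.
    by field.
  have qs : (x - x^-1) ^+ 2 + r ^+ 2 = (x ^+ 4 + 2 * a * x ^+ 2 + 1) / x ^+ 2.
    by rewrite rE; field.
  rewrite qV qs.
  under eq_bigr do rewrite mulrA.
  rewrite -mulr_suml.
  have := sum_bin_symmetric xn0 (ltnSn m).
  set S := \sum_(j < m.+1) _; set Q := _ + 1 in q0 *; move=> SE.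
  (* The factor 1 + x^-2 is (x + x^-1) x^-1, which exposes the left-hand side of [SE]. *)
  transitivity (((x + x^-1) * S) * (x^-1 / (Q / x ^+ 2) ^+ m.+1)); last first.
    by field; rewrite xn0 expf_neq0// mulf_neq0 ?invr_eq0 ?expf_neq0.
  have x2m : (x ^+ 2) ^+ m.+1 = x ^+ 2 * x ^+ (2 * m) by rewrite exprS -exprM.
  have x4m : (x ^+ 4) ^+ m.+1 = x ^+ 4 * (x ^+ (2 * m) * x ^+ (2 * m)).
    by rewrite -exprD addnn -mul2n mulnA exprS -exprM.
  rewrite SE !expr_div_n x2m x4m !(exprVn _ (2 * m).+1) (exprS x (2 * m)).
  by field; rewrite ?expf_neq0 ?q0 ?xn0.
Qed.

Lemma quarticP_sum (R : realType) (m : nat) (a : R) : -1 < a ->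
  quarticP m a = \sum_(j < m.+1) 'C(m + j, 2 * j)%:R * wallis R j m * (2 * (a + 1)) ^+ j.
Proof.
move=> a1; have b0 : 0 < 2 * (a + 1) by lra.
rewrite /quarticP N04E//; set r := Num.sqrt _.
have rn0 : r != 0 by rewrite gt_eqF// sqrtr_gt0.
have rE : r ^+ 2 = 2 * (a + 1) by rewrite sqr_sqrtr// ltW.
have pn0 : pi != 0 :> R by rewrite gt_eqF// pi_gt0.
(* One factor 2 splits off; the rest is (2(a+1))^(m+1/2) = r^(2m+1), which cancels the denominator
   common to all terms of [N04E]. *)
have powE : 2 `^ (m%:R + 3 / 2) * (a + 1) `^ (m%:R + 1 / 2) = 2 * r ^+ (2 * m).+1.
  have -> : m%:R + 3 / 2 = 1 + (m%:R + 1 / 2) :> R by field.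
  rewrite powRD ?pnatr_eq0 ?implybT// powRr1// -mulrA -powRM//; last by lra.
  rewrite powRD ?gt_eqF ?implybT// powR_mulrn ?ltW// div1r powR12_sqrt ?ltW//.
  by rewrite -/r -rE -exprM exprSr.
rewrite (mulrAC _ pi^-1) powE mulr_sumr; apply: eq_bigr => j _.
by rewrite -rE -exprM; move: pn0; generalize (pi : R) => p p0; field; rewrite p0 expf_neq0.
Qed.

(** * Identification of P_m and the coefficient formula *)

Lemma ratr_wallis (R : numFieldType) (j m : nat) : ratr (wallis rat j m) = wallis R j m.
Proof.
rewrite /wallis fmorph_div rmorphM !rmorph_prod/=.
by congr (_ * _ / _); apply: eq_bigr => i _; rewrite rmorphD rmorphM/= !ratr_nat ?rmorph1.
Qed.

Lemma quartic_poly_represents (R : realType) (m : nat) :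
  represents_quarticP R m (quartic_poly m).
Proof.
split=> [|a a1].
  rewrite /quartic_poly size_comp_poly2 ?size_XaddC// size_poly_eq//=.
  (* The coefficient at j = m is positive, so the degree is exactly m. *)
  have := taylor_coefE m 0; rewrite addn0 big_ord0 mulr1 => ->.
  by rewrite gt_eqF// divr_gt0// ?mulr_gt0 ?exprn_gt0 ?ltr0n ?fact_gt0.
rewrite quarticP_sum// /quartic_poly map_comp_poly horner_comp.
rewrite rmorphD/= map_polyX rmorph1 !hornerE.
rewrite (@horner_coef_wide _ m.+1) ?size_map_poly ?size_poly//.
apply: eq_bigr => j _; rewrite coef_map coef_taylor_poly /taylor_coef/=.
by rewrite rmorphM rmorphM rmorphXn/= !ratr_nat ratr_wallis exprMn mulrA.
Qed.

(** The difference has the distinct roots c+1, ..., c+n with n its size, which exceeds the degree of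
    a nonzero polynomial. *)
Lemma eq_poly_gt (R : realFieldType) (c : R) (p q : {poly R}) :
  (forall x, c < x -> p.[x] = q.[x]) -> p = q.
Proof.
move=> pq; apply/eqP; rewrite -subr_eq0; apply/eqP.
pose s := [seq c + i.+1%:R | i <- iota 0 (size (p - q))].
apply: (@roots_geq_poly_eq0 _ _ s).
- apply/allP => _ /mapP[i _ ->]; rewrite rootE hornerD hornerN pq ?subrr//.
  by rewrite ltrDl.
- rewrite map_inj_uniq ?iota_uniq// => i k /addrI /eqP.
  by rewrite eqr_nat => /eqP[].
- by rewrite size_map size_iota.
Qed.

(** Any other representing polynomial has the same values on ]-1, +oo[ once embedded in R, and that
    embedding is injective. *)
Lemma quarticP_polyE (R : realType) (m : nat) : quarticP_poly R m = quartic_poly m.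
Proof.
apply: xget_unique => [|p [_ pE]]; first exact: quartic_poly_represents.
apply: (map_poly_inj (@ratr R)); apply: (@eq_poly_gt _ (-1)) => a a1.
by rewrite -pE// (quartic_poly_represents R m).2.
Qed.

Theorem theorem6 (R : realType) (l : nat) :
  exists alpha beta : {poly int},
    forall m : nat, (0 < m)%N -> (l <= m)%N ->
      dcoef R l m =
        1 / (l`!%:R * m`!%:R * 2 ^+ (m + l)) *
        (alpha.[m%:Z]%:~R * \prod_(1 <= k < m.+1) (4 * k%:R - 1)
         - beta.[m%:Z]%:~R * \prod_(1 <= k < m.+1) (4 * k%:R + 1)).
Proof.
have [alpha [beta E]] := quartic_numE l.
exists alpha, beta => m _ _.
rewrite /dcoef quarticP_polyE -/(prod_4km1 m) -/(prod_4kp1 m) -E /quartic_num.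
by field; rewrite !factr_neq0 expf_neq0.
Qed.
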